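(* Let $N$ be an even nonnegative integer, let $\beta,\beta'>0$, and let $\bm{f}^\beta=(\hat f_0^\beta,\dots,\hat f_N^\beta)^\top\in\mathbb{R}^{N+1}$. Let $\mathcal{I}_\beta,\mathcal{I}_{\beta'}\in\mathbb{R}^{(N+1)\times 3}$ be the moment matrices and $\tilde{\bm f}^{\beta'}\in\mathbb{R}^{N+1}$ the $L^2$-projection coefficients defined in the context. Consider the constrained optimization problem $$\min_{\bm h\in\mathbb{R}^{N+1}}\ \|\bm h-\tilde{\bm f}^{\beta'}\|^2\qquad\text{subject to}\qquad \mathcal{I}_{\beta'}^\top\bm h=\mathcal{I}_\beta^\top\bm f^\beta,\qquad \|\bm h\|=\|\bm f^\beta\|.$$ Let $$\bm h_0=\mathcal{I}_{\beta'}\left(\mathcal{I}_{\beta'}^\top\mathcal{I}_{\beta'}\right)^{-1}\mathcal{I}_\beta^\top\bm f^\beta,\qquad \mathcal{P}=I_{N+1}-\mathcal{I}_{\beta'}\left(\mathcal{I}_{\beta'}^\top\mathcal{I}_{\beta'}\right)^{-1}\mathcal{I}_{\beta'}^\top,$$ where $I_{N+1}$ is the $(N+1)\times(N+1)$ identity matrix. The minimizer $\bm f^{\beta'}$ of the optimization problem depends on the consistency condition $\|\bm h_0\|\le\|\bm f^\beta\|$, and the solution is divided into the following three cases: 1. If $\|\bm h_0\|\le\|\bm f^\beta\|$ and $\mathcal{P}\tilde{\bm f}^{\beta'}\ne 0$, then $$\bm f^{\beta'}=\bm h_0+\alpha\,\mathcal{P}\tilde{\bm f}^{\beta'},\qquad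 \alpha=\frac{\sqrt{\|\bm f^\beta\|^2-\|\bm h_0\|^2}}{\|\mathcal{P}\tilde{\bm f}^{\beta'}\|}.$$ 2. If $\|\bm h_0\|\le\|\bm f^\beta\|$ and $\mathcal{P}\tilde{\bm f}^{\beta'}=0$, then the minimizer is not unique. The solution is given by $$\bm f^{\beta'}=\bm h_0+\alpha\,\bm u_0,\qquad \alpha=\frac{\sqrt{\|\bm f^\beta\|^2-\|\bm h_0\|^2}}{\|\bm u_0\|},\qquad\text{for all nonzero } \bm u_0\in\mathrm{Null}(\mathcal{I}_{\beta'}^\top).$$ 3. If $\|\bm h_0\|\le\|\bm f^\beta\|$ does not hold, then the constrained optimization problem is infeasible.
   Context: $\|\cdot\|$ is the Euclidean norm on $\mathbb{R}^{N+1}$ and $\mathrm{Null}(A)$ denotes the null space of a matrix $A$. Symmetrically weighted Hermite functions: for $\beta>0$ and $k\ge0$, $$\mathcal{H}_k^\beta(v)=\frac{\sqrt\beta}{\pi^{1/4}\sqrt{2^kk!}}\,H_k(\beta v)\,e^{-\beta^2v^2/2},\qquad H_k(v)=(-1)^ke^{v^2}\frac{\mathrm{d}^k}{\mathrm{d}v^k}e^{-v^2};$$ they form a complete orthonormal basis of $L^2(\mathbb{R})$. Moment matrices: $\mathcal{I}_\beta=(I_{k,r}^\beta)_{0\le k\le N,\,0\le r\le 2}\in\mathbb{R}^{(N+1)\times3}$, where $I_{k,r}^\beta=\int_{\mathbb{R}}v^r\mathcal{H}_k^\beta(v)\,\mathrm{d}v$; explicitly, with $c_k=\sqrt{(k-1)!!/k!!}$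 and $(-1)!!=0!!=1$: for $k$ even, $I_{k,0}^\beta=2^{1/2}\pi^{1/4}\beta^{-1/2}c_k$, $I_{k,1}^\beta=0$, $I_{k,2}^\beta=\beta^{-2}I_{k,0}^\beta+2^{3/2}\pi^{1/4}\beta^{-5/2}k\,c_k$; for $k$ odd, $I_{k,0}^\beta=I_{k,2}^\beta=0$, $I_{k,1}^\beta=2\pi^{1/4}\beta^{-3/2}c_k^{-1}$. The matrix $\mathcal{I}_{\beta'}^\top\mathcal{I}_{\beta'}\in\mathbb{R}^{3\times 3}$ is invertible. $L^2$-projection coefficients: with $f_N^\beta(v)=\sum_{k=0}^N\hat f_k^\beta\,\mathcal{H}_k^\beta(v)$, set $\tilde f_k^{\beta'}=\int_{\mathbb{R}}\mathcal{H}_k^{\beta'}(v)f_N^\beta(v)\,\mathrm{d}v$ for $0\le k\le N$, and $\tilde{\bm f}^{\beta'}=(\tilde f_0^{\beta'},\dots,\tilde f_N^{\beta'})^\top$.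
   Formalization: In case 2 non-uniqueness is claimed only for N>2 and ‖h_0‖<‖f^β‖ (it fails otherwise, e.g. f^β=0); for N=2 with ‖h_0‖=‖f^β‖, where no nonzero u_0 exists, h_0 is added as the minimizer. Invertibility of the Gram matrix is assumed, excluding N=0, where it fails. *)

(* Defs.v *)
From HB Require Import structures.
From mathcomp Require Import all_boot all_order all_algebra.
From mathcomp Require Import all_classical all_reals all_analysis.

Set Implicit Arguments.
Unset Strict Implicit.
Unset Printing Implicit Defensive.

Import Order.TTheory GRing.Theory Num.Theory.
Import numFieldNormedType.Exports.

Local Open Scope classical_set_scope.
Local Open Scope ring_scope.

(* The library norm `|x| on matrices is the sup norm, hence this definition. *)
Definition enorm (R : realType) (n : nat) (x : 'cV[R]_n) : R :=
  Num.sqrt (\sum_(i < n) x i 0 ^+ 2).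

(* Physicists' Hermite polynomials (Rodrigues formula), as functions. *)
Definition hermite (R : realType) (k : nat) (v : R) : R :=
  (-1) ^+ k * expR (v ^+ 2)
  * (derive1n k (fun x : R => expR (- x ^+ 2)) : R -> R) v.

Definition hermite_fun (R : realType) (beta : R) (k : nat) (v : R) : R :=
  Num.sqrt beta / (powR pi (4%:R^-1) * Num.sqrt (2 ^+ k * k`!%:R))
  * hermite k (beta * v) * expR (- (beta ^+ 2 * v ^+ 2 / 2)).

Definition moment_mx (R : realType) (N : nat) (beta : R) : 'M[R]_(N.+1, 3) :=
  \matrix_(k < N.+1, r < 3)
    (\int[lebesgue_measure]_(v in [set: R]) (v ^+ r * hermite_fun beta k v))%R.

Definition hermite_expansion (R : realType) (N : nat) (beta : R)
    (f : 'cV[R]_N.+1) (v : R) : R :=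
  \sum_(k < N.+1) f k 0 * hermite_fun beta k v.

(* Coefficients, with respect to the scaling beta', of the L^2-projection of
   the expansion with scaling beta and coefficients f. *)
Definition L2_proj_coef (R : realType) (N : nat) (beta beta' : R)
    (f : 'cV[R]_N.+1) : 'cV[R]_N.+1 :=
  \col_(k < N.+1)
    (\int[lebesgue_measure]_(v in [set: R])
       (hermite_fun beta' k v * hermite_expansion beta f v))%R.

Definition feasible (R : realType) (N : nat) (beta beta' : R)
    (f h : 'cV[R]_N.+1) : Prop :=
  (moment_mx N beta')^T *m h = (moment_mx N beta)^T *m f /\ enorm h = enorm f.

Definition minimizer (R : realType) (N : nat) (beta beta' : R)
    (f h : 'cV[R]_N.+1) : Prop :=
  feasible beta beta' f h /\
  forall g : 'cV[R]_N.+1, feasible beta beta' f g ->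
    enorm (h - L2_proj_coef beta beta' f) ^+ 2
    <= enorm (g - L2_proj_coef beta beta' f) ^+ 2.

Definition h0_vec (R : realType) (N : nat) (beta beta' : R)
    (f : 'cV[R]_N.+1) : 'cV[R]_N.+1 :=
  moment_mx N beta' *m invmx ((moment_mx N beta')^T *m moment_mx N beta')
  *m (moment_mx N beta)^T *m f.

Definition proj_mx_null (R : realType) (N : nat) (beta' : R) : 'M[R]_N.+1 :=
  1%:M - moment_mx N beta'
         *m invmx ((moment_mx N beta')^T *m moment_mx N beta')
         *m (moment_mx N beta')^T.

(* Main.v *)
Require Import Defs.
From HB Require Import structures.
From mathcomp Require Import all_boot all_order all_algebra.
From mathcomp Require Import all_classical all_reals all_analysis.
From mathcomp Require Import ring lra.

(** Let [A := moment_mx N beta'].  The problem is Euclidean geometry: find the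
    points closest to [t := L2_proj_coef beta beta' f] in the intersection of an
    affine subspace of direction Null(A^T) with a sphere centered at the origin.

    Write [b] for the prescribed moments.  The vector [A (A^T A)^-1 b] solves
    [A^T h = b] and lies in the column space of [A], which is the orthogonal
    complement of Null(A^T); hence every solution is [h = h0 + w] with [w] in
    Null(A^T), and Pythagoras gives [|h|^2 = |h0|^2 + |w|^2].  The feasible set
    is therefore empty if [|h0| > |f|], and otherwise it is the sphere of radius
    [rho = sqrt (|f|^2 - |h0|^2)] around [h0] in Null(A^T)
    ([constraint_sphereP]).

    On that sphere the distance to the target [t] satisfies
    [|h - t|^2 = |h0 - t|^2 + rho^2 - 2 <w, P t>] ([constraint_distE]), because
    [P] is the orthogonal projection onto Null(A^T).  Minimizing means
    maximizing the linear form [<w, P t>] over a sphere.  If [P t != 0], the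
    equality case of Cauchy-Schwarz singles out [w = (rho / |P t|) P t]
    ([closest_on_sphere_proj_neq0]).  If [P t = 0], the objective is constant and
    all points of the sphere are minimizers ([closest_on_sphere_proj_eq0]); by
    [on_sphereP], each of them is [h0 + (rho / |u0|) u0] with [u0 = w], unless
    [w = 0], where any nonzero [u0] in Null(A^T) does.  Counting dimensions,
    such a [u0] exists as soon as [N > 2], while invertibility of the 3 x 3 Gram
    matrix forces [N >= 2]. *)

Set Implicit Arguments.
Unset Strict Implicit.
Unset Printing Implicit Defensive.

Import Order.TTheory GRing.Theory Num.Theory.
Import numFieldNormedType.Exports.

Local Open Scope ring_scope.

(** * Euclidean inner product on column vectors *)

Definition dotc (R : realType) (n : nat) (x y : 'cV[R]_n) : R :=
  (x^T *m y) 0 0.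

Section Dot.
Variables (R : realType) (n : nat).
Implicit Types (x y z : 'cV[R]_n) (a : R).

Lemma dotcC x y : dotc x y = dotc y x.
Proof. by rewrite /dotc !mxE; apply: eq_bigr => i _; rewrite !mxE mulrC. Qed.

Lemma dotcDr x y z : dotc x (y + z) = dotc x y + dotc x z.
Proof. by rewrite /dotc mulmxDr mxE. Qed.

Lemma dotcZr a x y : dotc x (a *: y) = a * dotc x y.
Proof. by rewrite /dotc -scalemxAr mxE. Qed.

Lemma dotcDl x y z : dotc (x + y) z = dotc x z + dotc y z.
Proof. by rewrite dotcC dotcDr !(dotcC z). Qed.

Lemma dotcZl a x y : dotc (a *: x) y = a * dotc x y.
Proof. by rewrite dotcC dotcZr dotcC. Qed.

Lemma dotcNr x y : dotc x (- y) = - dotc x y.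
Proof. by rewrite -scaleN1r dotcZr mulN1r. Qed.

Lemma dotcNl x y : dotc (- x) y = - dotc x y.
Proof. by rewrite dotcC dotcNr dotcC. Qed.

Lemma dotc0r x : dotc x 0 = 0.
Proof. by rewrite /dotc mulmx0 mxE. Qed.

Lemma enorm_ge0 x : 0 <= enorm x.
Proof. exact: sqrtr_ge0. Qed.

Lemma enorm_sqr x : enorm x ^+ 2 = dotc x x.
Proof.
rewrite /enorm sqr_sqrtr; last by apply: sumr_ge0 => i _; exact: sqr_ge0.
by rewrite /dotc mxE; apply: eq_bigr => i _; rewrite mxE expr2.
Qed.

Lemma enorm_eq0 x : (enorm x == 0) = (x == 0).
Proof.
apply/idP/eqP => [|->]; last first.
  by rewrite /enorm big1 ?sqrtr0 // => i _; rewrite mxE expr0n.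
rewrite -sqrf_eq0 enorm_sqr /dotc mxE.
rewrite psumr_eq0 => [/allP x0|i _]; last by rewrite mxE -expr2 sqr_ge0.
apply/colP => i; rewrite [RHS]mxE; apply/eqP.
by have := x0 i (mem_index_enum i); rewrite mxE /= mulf_eq0 orbb.
Qed.

Lemma enorm_gt0 x : (0 < enorm x) = (x != 0).
Proof. by rewrite lt0r enorm_ge0 andbT enorm_eq0. Qed.

Lemma enormZ a x : enorm (a *: x) = `|a| * enorm x.
Proof.
apply/eqP; rewrite -(@eqrXn2 _ 2%N) ?mulr_ge0 ?enorm_ge0 //.
by rewrite exprMn !enorm_sqr dotcZl dotcZr mulrA -expr2 real_normK ?num_real.
Qed.

Lemma enorm_rescale a x : 0 <= a -> x != 0 -> enorm ((a / enorm x) *: x) = a.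
Proof.
move=> a0 x0; rewrite enormZ ger0_norm ?divr_ge0 ?enorm_ge0 //.
by rewrite divfK // enorm_eq0.
Qed.

(** Expanding the square measures the defect in the Cauchy-Schwarz inequality,
    which yields both the inequality and its equality case. *)
Lemma cauchy_schwarz_defect x y :
  enorm (enorm y *: x - enorm x *: y) ^+ 2 =
  2 * (enorm x * enorm y) * (enorm x * enorm y - dotc x y).
Proof.
rewrite enorm_sqr !(dotcDl, dotcDr, dotcNl, dotcNr, dotcZl, dotcZr).
rewrite (dotcC y x) -!enorm_sqr; ring.
Qed.

Lemma dotc_le_enorm x y : dotc x y <= enorm x * enorm y.
Proof.
have [->|x0] := eqVneq x 0; first by rewrite dotcC dotc0r mulr_ge0 ?enorm_ge0.
have [->|y0] := eqVneq y 0; first by rewrite dotc0r mulr_ge0 ?enorm_ge0.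
have : 0 <= enorm (enorm y *: x - enorm x *: y) ^+ 2 by exact: sqr_ge0.
rewrite cauchy_schwarz_defect pmulr_rge0 ?subr_ge0 //.
by rewrite !mulr_gt0 ?enorm_gt0.
Qed.

Lemma dotc_ge_enorm_colinear x y : y != 0 ->
  enorm x * enorm y <= dotc x y -> x = (enorm x / enorm y) *: y.
Proof.
move=> y0 le_xy.
have eq_xy : dotc x y = enorm x * enorm y.
  by apply: le_anti; rewrite dotc_le_enorm.
have /eqP := cauchy_schwarz_defect x y.
rewrite eq_xy subrr mulr0 expf_eq0 /= enorm_eq0 subr_eq0 => /eqP eq_yx.
by rewrite mulrC -scalerA -eq_yx scalerA mulVf ?scale1r // enorm_eq0.
Qed.

End Dot.

(** * Linear constraints with an invertible Gram matrix *)

Section Constraint.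
Variables (R : realType) (n m : nat) (A : 'M[R]_(n, m)).
Hypothesis gram_unit : A^T *m A \in unitmx.
Implicit Types (b : 'cV[R]_m) (h t w : 'cV[R]_n).

(** Here [A (A^T A)^-1] is the Moore-Penrose pseudo-inverse of [A^T], hence the
    name; [enorm_least_norm_sol_le] justifies it. *)
Definition least_norm_sol b : 'cV[R]_n := A *m (invmx (A^T *m A) *m b).

Definition null_proj : 'M[R]_n := 1%:M - A *m invmx (A^T *m A) *m A^T.

Lemma least_norm_solP b : A^T *m least_norm_sol b = b.
Proof. by rewrite /least_norm_sol mulmxA mulKVmx. Qed.

Lemma null_projP t : A^T *m (null_proj *m t) = 0.
Proof.
by rewrite mulmxA mulmxBr mulmx1 !mulmxA mulmxV // mul1mx subrr mul0mx.
Qed.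

(** Null(A^T) and the column space of [A] are orthogonal; all the geometry below
    rests on this. *)
Lemma dotc_null_col w (c : 'cV[R]_m) : A^T *m w = 0 -> dotc w (A *m c) = 0.
Proof.
move=> Aw; rewrite /dotc mulmxA -[A]trmxK -trmx_mul Aw trmx0 mul0mx.
by rewrite mxE.
Qed.

(** [t - null_proj *m t] lies in the column space of [A], so a vector of
    Null(A^T) does not see it. *)
Lemma dotc_null_proj w t : A^T *m w = 0 -> dotc w (null_proj *m t) = dotc w t.
Proof.
move=> Aw; rewrite /null_proj mulmxBl mul1mx -!mulmxA dotcDr dotcNr.
by rewrite dotc_null_col // subr0.
Qed.

Lemma null_sub_least_norm_sol b h :
  (A^T *m h = b) <-> (A^T *m (h - least_norm_sol b) = 0).
Proof.
rewrite mulmxBr least_norm_solP.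
by split=> [->|/eqP]; [rewrite subrr | rewrite subr_eq0 => /eqP].
Qed.

(** The least-norm solution lies in the column space of [A], and its difference
    with any other solution in the orthogonal complement of that space. *)
Lemma constraint_pythagoras b h : A^T *m h = b ->
  enorm h ^+ 2 =
  enorm (least_norm_sol b) ^+ 2 + enorm (h - least_norm_sol b) ^+ 2.
Proof.
move=> /(null_sub_least_norm_sol b h).1 Aw.
have w_perp : dotc (h - least_norm_sol b) (least_norm_sol b) = 0.
  exact: dotc_null_col.
rewrite -{1}(subrK (least_norm_sol b) h).
move: (h - least_norm_sol b) w_perp => w w_perp.
rewrite !enorm_sqr !(dotcDl, dotcDr) (dotcC (least_norm_sol b) w) w_perp; ring.
Qed.

Lemma enorm_least_norm_sol_le b h : A^T *m h = b ->
  enorm (least_norm_sol b) <= enorm h.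
Proof.
move=> Ah; rewrite -ler_sqr ?nnegrE ?enorm_ge0 //.
by rewrite (constraint_pythagoras Ah) lerDl sqr_ge0.
Qed.

(** By Pythagoras, intersecting the affine constraint with the sphere of radius
    [c] around the origin is intersecting it with a sphere around the least-norm
    solution; recentering there turns the affine constraint into a linear one. *)
Lemma constraint_sphereP b c h : enorm (least_norm_sol b) <= c ->
  (A^T *m h = b /\ enorm h = c) <->
  (A^T *m (h - least_norm_sol b) = 0 /\
   enorm (h - least_norm_sol b) =
     Num.sqrt (c ^+ 2 - enorm (least_norm_sol b) ^+ 2)).
Proof.
move=> le_c.
have c0 : 0 <= c by apply: le_trans le_c; exact: enorm_ge0.
split=> [[Ah <-]|[/(null_sub_least_norm_sol b h).2 Ah eq_rho]].
  split; first exact: (null_sub_least_norm_sol b h).1 Ah.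
  by rewrite (constraint_pythagoras Ah) addrAC subrr add0r sqrtr_sqr
    ger0_norm ?enorm_ge0.
split=> //; apply/eqP; rewrite -(@eqrXn2 _ 2%N) ?enorm_ge0 //.
have rho2_ge0 : 0 <= c ^+ 2 - enorm (least_norm_sol b) ^+ 2.
  by rewrite subr_ge0 ler_sqr ?nnegrE ?enorm_ge0.
by rewrite (constraint_pythagoras Ah) eq_rho (sqr_sqrtr rho2_ge0) subrKC.
Qed.

(** The column-space part of [t] is constant along the constraint set, so the
    distance to [t] depends on the direction only through [null_proj *m t]. *)
Lemma constraint_distE b h t : A^T *m h = b ->
  enorm (h - t) ^+ 2 =
  enorm (least_norm_sol b - t) ^+ 2 + enorm (h - least_norm_sol b) ^+ 2
  - 2 * dotc (h - least_norm_sol b) (null_proj *m t).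
Proof.
move=> /(null_sub_least_norm_sol b h).1 Aw; rewrite (dotc_null_proj _ Aw).
have w_perp : dotc (h - least_norm_sol b) (least_norm_sol b) = 0.
  exact: dotc_null_col.
have -> : h - t = (h - least_norm_sol b) + (least_norm_sol b - t).
  by rewrite addrA subrK.
move: (h - least_norm_sol b) w_perp => w w_perp.
rewrite !enorm_sqr !(dotcDl, dotcDr, dotcNl, dotcNr).
rewrite (dotcC (least_norm_sol b) w) (dotcC t w) w_perp; ring.
Qed.

(** The Gram matrix factors through the space of dimension [n]. *)
Lemma gram_unit_leq : (m <= n)%N.
Proof.
rewrite -(mxrank_unit gram_unit).
exact: leq_trans (mxrankM_maxr _ _) (rank_leq_row _).
Qed.

End Constraint.

Lemma trmx_null_nonzero (R : realType) (n m : nat) (A : 'M[R]_(n, m)) :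
  (m < n)%N -> exists2 u : 'cV[R]_n, A^T *m u = 0 & u != 0.
Proof.
move=> lt_mn; have ker_neq0 : kermx A != 0.
  by rewrite -mxrank_eq0 mxrank_ker subn_eq0 -ltnNge (leq_ltn_trans (rank_leq_col A)).
have [u ker_u u_neq0] := rowV0Pn ker_neq0.
exists u^T; last by rewrite trmx_eq0.
by rewrite -trmx_mul (sub_kermxP ker_u) trmx0.
Qed.

(** * Closest points of a sphere in an affine subspace *)

Section ClosestPoint.
Variables (R : realType) (n m : nat) (A : 'M[R]_(n, m)).
Variables (b : 'cV[R]_m) (c : R) (t : 'cV[R]_n).
Implicit Types (g h u : 'cV[R]_n).

Definition on_sphere h : Prop := A^T *m h = b /\ enorm h = c.

Definition closest_on_sphere h : Prop :=
  on_sphere h /\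
  forall g, on_sphere g -> enorm (h - t) ^+ 2 <= enorm (g - t) ^+ 2.

Hypothesis gram_unit : A^T *m A \in unitmx.

Let h0 := least_norm_sol A b.
Let Pt := null_proj A *m t.
Let rho := Num.sqrt (c ^+ 2 - enorm h0 ^+ 2).

Lemma on_sphere_least_norm h : on_sphere h -> enorm h0 <= c.
Proof. by case=> Ah <-; exact: enorm_least_norm_sol_le. Qed.

Hypothesis le_c : enorm h0 <= c.

Lemma on_sphere_radius h : on_sphere h -> enorm (h - h0) = rho.
Proof. by move=> /(constraint_sphereP gram_unit h le_c).1 []. Qed.

Lemma on_sphere_null h : on_sphere h -> A^T *m (h - h0) = 0.
Proof. by move=> /(constraint_sphereP gram_unit h le_c).1 []. Qed.

Lemma on_sphere_ray u : A^T *m u = 0 -> u != 0 ->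
  on_sphere (h0 + (rho / enorm u) *: u).
Proof.
move=> Au u0; apply: (constraint_sphereP gram_unit _ le_c).2.
rewrite addrC addKr -scalemxAr Au scaler0 enorm_rescale //.
exact: sqrtr_ge0.
Qed.

Lemma on_sphere_center : enorm h0 = c -> on_sphere h0.
Proof. by move=> eq_c; split=> //; exact: least_norm_solP. Qed.

Lemma on_sphere_distE h : on_sphere h ->
  enorm (h - t) ^+ 2 =
  enorm (h0 - t) ^+ 2 + rho ^+ 2 - 2 * dotc (h - h0) Pt.
Proof.
by move=> Sh; rewrite -(on_sphere_radius Sh); apply: constraint_distE; case: Sh.
Qed.

(** The displacement from [h0] has fixed norm [rho], so by [on_sphere_distE] the
    distance is least when its product with [Pt] attains the Cauchy-Schwarz bound
    [rho * enorm Pt], which only the nonnegative multiple of [Pt] of norm [rho]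
    does. *)
Lemma closest_on_sphere_proj_neq0 h : Pt != 0 ->
  closest_on_sphere h <-> h = h0 + (rho / enorm Pt) *: Pt.
Proof.
move=> Pt0; set hs := h0 + _.
have Shs : on_sphere hs by apply: on_sphere_ray => //; exact: null_projP.
have dot_hs : dotc (hs - h0) Pt = rho * enorm Pt.
  by rewrite /hs addrC addKr dotcZl -enorm_sqr expr2 mulrA divfK ?enorm_eq0.
split=> [[Sh h_min]|->].
  have := h_min _ Shs; rewrite (on_sphere_distE Sh) (on_sphere_distE Shs) dot_hs => le_dot.
  rewrite /hs -(on_sphere_radius Sh) -dotc_ge_enorm_colinear ?subrKC //.
  by rewrite (on_sphere_radius Sh); move: le_dot; lra.
split=> // g Sg; rewrite (on_sphere_distE Sg) (on_sphere_distE Shs) dot_hs.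
by have := dotc_le_enorm (g - h0) Pt; rewrite (on_sphere_radius Sg); lra.
Qed.

(** When [t] has no component in Null(A^T), all points of the sphere are
    equidistant from it. *)
Lemma closest_on_sphere_proj_eq0 h : Pt = 0 ->
  closest_on_sphere h <-> on_sphere h.
Proof.
move=> Pt0; split=> [[]//|Sh]; split=> // g Sg.
by rewrite (on_sphere_distE Sh) (on_sphere_distE Sg) Pt0 !dotc0r.
Qed.

(** The zero displacement has no direction of its own; when the null space is
    nontrivial it is still of the form [0 *: u], and when [m = n] it is the only
    displacement. *)
Lemma on_sphereP h : on_sphere h <->
  (exists u, [/\ A^T *m u = 0, u != 0 & h = h0 + (rho / enorm u) *: u])
  \/ [/\ n = m, enorm h0 = c & h = h0].
Proof.
split=> [Sh|[[u [Au u_neq0 ->]]|[_ eq_c ->]]]; last 2 first.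
- exact: on_sphere_ray.
- exact: on_sphere_center.
have [h_eq|h_neq] := eqVneq h h0; last first.
  have w_neq0 : h - h0 != 0 by rewrite subr_eq0.
  left; exists (h - h0); split=> //; first exact: on_sphere_null.
  by rewrite -(on_sphere_radius Sh) divff ?enorm_eq0 // scale1r subrKC.
have rho0 : rho = 0.
  by apply/eqP; rewrite -(on_sphere_radius Sh) enorm_eq0 h_eq subrr.
have := gram_unit_leq gram_unit; rewrite leq_eqVlt => /orP[/eqP mn|lt_mn].
  by right; split=> //; rewrite -h_eq; case: Sh.
have [u Au u_neq0] := trmx_null_nonzero A lt_mn.
by left; exists u; split=> //; rewrite rho0 mul0r scale0r addr0.
Qed.

(** Opposite directions in the null space give antipodal points, which differ as
    soon as the radius is positive. *)
Lemma on_sphere_not_unique : (m < n)%N -> enorm h0 < c ->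
  exists h1 h2, [/\ on_sphere h1, on_sphere h2 & h1 != h2].
Proof.
move=> lt_mn lt_c; have [u Au u_neq0] := trmx_null_nonzero A lt_mn.
exists (h0 + (rho / enorm u) *: u), (h0 + (rho / enorm (- u)) *: (- u)).
split; [exact: on_sphere_ray | |].
  by apply: on_sphere_ray; rewrite ?oppr_eq0 // mulmxN Au oppr0.
have rho_gt0 : 0 < rho.
  rewrite sqrtr_gt0 subr_gt0 ltr_sqr ?nnegrE ?enorm_ge0 //.
  exact: le_trans (enorm_ge0 _) le_c.
have -> : enorm (- u) = enorm u.
  by rewrite -scaleN1r enormZ normrN1 mul1r.
rewrite (inj_eq (addrI h0)) -subr_eq0 scalerN opprK -mulr2n -scaler_nat.
by rewrite !scaler_eq0 invr_eq0 enorm_eq0 pnatr_eq0 (negPf u_neq0) 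
  (gt_eqF rho_gt0).
Qed.

End ClosestPoint.

(* The Gram matrix is singular for N = 0, so its invertibility is a hypothesis.
   In the second case, if N = 2 then Null(I_{beta'}^T) = {0}, so that h0 is the
   minimizer when enorm h0 = enorm f although no nonzero u0 exists; and if
   enorm h0 = enorm f then alpha = 0 and h0 is the only minimizer. *)
Theorem proposition4p1 (R : realType) (N : nat) (beta beta' : R)
    (f : 'cV[R]_N.+1)
    (N_even : ~~ odd N) (beta_gt0 : 0 < beta) (beta'_gt0 : 0 < beta')
    (gram_unit : (moment_mx N beta')^T *m moment_mx N beta' \in unitmx) :
  let h0 := h0_vec beta beta' f in
  let Pf := proj_mx_null N beta' *m L2_proj_coef beta beta' f in
  let rho := Num.sqrt (enorm f ^+ 2 - enorm h0 ^+ 2) in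
  [/\ enorm h0 <= enorm f -> Pf != 0 ->
        forall h : 'cV[R]_N.+1,
          minimizer beta beta' f h <-> h = h0 + (rho / enorm Pf) *: Pf,
      enorm h0 <= enorm f -> Pf = 0 ->
        (forall h : 'cV[R]_N.+1,
           minimizer beta beta' f h <->
           (exists u0 : 'cV[R]_N.+1,
              [/\ (moment_mx N beta')^T *m u0 = 0, u0 != 0 &
                  h = h0 + (rho / enorm u0) *: u0])
           \/ [/\ N = 2%N, enorm h0 = enorm f & h = h0])
        /\
        ((2 < N)%N -> enorm h0 < enorm f ->
           exists h1 h2 : 'cV[R]_N.+1,
             [/\ minimizer beta beta' f h1, minimizer beta beta' f h2 &
                 h1 != h2])
    & ~ (enorm h0 <= enorm f) ->
        ~ exists h : 'cV[R]_N.+1, feasible beta beta' f h].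
Proof.
have h0E : h0_vec beta beta' f =
    least_norm_sol (moment_mx N beta') ((moment_mx N beta)^T *m f).
  by rewrite /h0_vec /least_norm_sol !mulmxA.
rewrite h0E => h0 Pf rho; split=> [le_f Pf0 h|le_f Pf0|nle_f [h Sh]].
- exact: (closest_on_sphere_proj_neq0 gram_unit le_f).
- have minE h := closest_on_sphere_proj_eq0 gram_unit le_f h Pf0.
  split=> [h|N_gt2 lt_f].
    apply: (iff_trans (minE h)).
    apply: (iff_trans (on_sphereP gram_unit le_f h)).
    split=> -[ray|[eq_n eq_f eq_h]]; try by left.
      by right; split=> //; case: eq_n.
    by right; split=> //; rewrite eq_n.
  have [h1 [h2 [S1 S2 neq12]]] :=
    on_sphere_not_unique gram_unit le_f N_gt2 lt_f.
  by exists h1, h2; split=> //; [exact: (minE h1).2 | exact: (minE h2).2].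
- exact/nle_f/(on_sphere_least_norm gram_unit Sh).
Qed.
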